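(* Let $\delta_F = \sup\{F((G,\sigma)) - F_c((G,\sigma)) : (G,\sigma)\text{ is a flow-admissible signed graph}\}$. Then $\delta_F \ge 2$.
   Context: Graphs are finite and may have parallel edges but no loops. A signed graph $(G,\sigma)$ is a graph $G$ with a function (signature) $\sigma: E(G)\to\{\pm1\}$. Each edge $e=uv$ is divided into two half-edges $h_e^u$ (incident with $u$) and $h_e^v$ (incident with $v$); $H(G)$ is the set of half-edges, $H(v)$ the set of half-edges incident with $v$, and $e_h$ the edge containing the half-edge $h$. An orientation of $(G,\sigma)$ is a function $\tau: H(G)\to\{\pm1\}$ with $\tau(h_e^u)\tau(h_e^v) = -\sigma(e)$ for each edge $e=uv$. Given an orientation $\tau$, the boundary of $f:E(G)\to\mathbb{R}$ is $\delta f(v)=\sum_{h\in H(v)}\tau(h)f(e_h)$. For real $r\ge 2$, $f$ is an $r$-flow on $(G,\sigma)$ if, for every edge $e$, $f(e)=0$ or $1\le |f(e)|\le r-1$, and $\delta f(v)=0$ for all $v\in V(G)$; it is nowhere-zero if $f(e)\ne 0$ for all $e$. $(G,\sigma)$ admits a nowhere-zero $r$-flow if one exists for some orientation, and $(G,\sigma)$ is flow-admissible if it admits a nowhere-zero $r$-flow for some $r\ge2$. $F_c((G,\sigma))=\inf\{r : (G,\sigma)\text{ admits a nowhere-zero }r\text{-flow}\}$, and $F((G,\sigma))$ is the smallest integer $k$ such that $(G,\sigma)$ admits an integer-valued nowhere-zero $k$-flow. *)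

(* Defs.v *)
From HB Require Import structures.
From mathcomp Require Import all_boot all_order all_algebra.
From mathcomp Require Import all_classical all_reals all_analysis.

Set Implicit Arguments.
Unset Strict Implicit.
Unset Printing Implicit Defensive.

Import Order.TTheory GRing.Theory Num.Theory.

Local Open Scope classical_set_scope.
Local Open Scope ring_scope.

(* Finite loopless signed multigraph. The two halves of an edge e are (e, true)
   and (e, false); the numbering is arbitrary and nothing below depends on it.
   A sign is a boolean b standing for (-1) ^+ b, so true means -1. *)
Record signed_graph := SignedGraph {
  vertex : finType;
  edge : finType;
  incident_vertex : edge * bool -> vertex;
  signature : edge -> bool;
  loopless : forall e, incident_vertex (e, true) != incident_vertex (e, false)
}.

Definition half_edge (G : signed_graph) : finType := (edge G * bool)%type.

Definition is_orientation (G : signed_graph) (tau : half_edge G -> bool) : Prop :=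
  forall e : edge G,
    (-1) ^+ tau (e, true) * (-1) ^+ tau (e, false) = - (-1) ^+ signature e :> int.

Definition boundary (R : realType) (G : signed_graph) (tau : half_edge G -> bool)
    (f : edge G -> R) (v : vertex G) : R :=
  \sum_(h : half_edge G | incident_vertex h == v) (-1) ^+ tau h * f h.1.

Definition is_flow (R : realType) (G : signed_graph) (tau : half_edge G -> bool)
    (r : R) (f : edge G -> R) : Prop :=
  [/\ 2 <= r,
      forall e, f e = 0 \/ 1 <= `|f e| <= r - 1
    & forall v, boundary tau f v = 0].

Definition nowhere_zero (R : realType) (G : signed_graph) (f : edge G -> R) : Prop :=
  forall e, f e != 0.

Definition admits_nz_flow (R : realType) (G : signed_graph) (r : R) : Prop :=
  exists (tau : half_edge G -> bool) (f : edge G -> R),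
    [/\ is_orientation tau, is_flow tau r f & nowhere_zero f].

Definition admits_nz_integer_flow (R : realType) (G : signed_graph) (k : nat) : Prop :=
  exists (tau : half_edge G -> bool) (f : edge G -> R),
    [/\ is_orientation tau, is_flow tau k%:R f, nowhere_zero f
      & forall e, f e \is a Num.int].

Definition flow_admissible (R : realType) (G : signed_graph) : Prop :=
  exists r : R, admits_nz_flow G r.

Definition circular_flow_number (R : realType) (G : signed_graph) : R :=
  inf [set r : R | admits_nz_flow G r].

(* Integers k < 2 never qualify, so searching in nat is enough. The default 0 is
   only reached when there is no integer flow, hence never for a flow-admissible
   graph. *)
Definition integer_flow_number (R : realType) (G : signed_graph) : nat :=
  xget 0%N [set k | admits_nz_integer_flow R G k /\
                    forall j, admits_nz_integer_flow R G j -> (k <= j)%N].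

Definition delta_F (R : realType) : \bar R :=
  ereal_sup [set x : \bar R | exists G : signed_graph, flow_admissible R G /\
    x = ((integer_flow_number R G)%:R - circular_flow_number R G)%:E].

(* Main.v *)
Require Import Defs.
From HB Require Import structures.
From mathcomp Require Import all_boot all_order all_algebra.
From mathcomp Require Import all_classical all_reals all_analysis.
From mathcomp Require Import ring lra.

Set Implicit Arguments.
Unset Strict Implicit.
Unset Printing Implicit Defensive.

Import Order.TTheory GRing.Theory Num.Theory.

Local Open Scope ring_scope.

(** It suffices to exhibit, for every [t > 0], a signed graph with
    [F_c <= 2 + 1/t] and [F >= 4]: its gap is at least [2 - 1/t].

    Take a central vertex with an odd number of bridges, each leading to a block
    that consists of two vertices joined by positive and negative edges in equal
    number.  Adding up the conservation laws at the two vertices of a block, the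
    positive edges cancel and each negative edge counts twice, up to sign: in an
    integer flow every bridge therefore carries an even value ([bridge_even]).  In
    an integer flow with all values at most [2] in absolute value, every
    bridge would carry [2] or [-2], and an odd number of such values cannot cancel
    at the centre ([odd_sum_neq0]).  Hence [F >= 4]
    ([bridge_star_integer_flow_ge4]).

    Real flows do not see this parity.  With [2t+1] bridges, [t] of them may bring
    [1 + 1/t] into the centre while the [t+1] others take [1] out of it.  To feed
    a value [g] into a bridge, a block with [2t] edges of each sign makes half of
    its edges carry [1] one way and the other half carry the slightly larger
    [1 + |g|/(2t)] the other way.  All absolute values lie between [1] and [1 + 1/t],
    so this is a [(2 + 1/t)]-flow ([odd_star_flowP]).  Its values are rational, so a
    multiple of it is an integer flow; thus [F] is the minimum of a nonempty set
    and the bound [F >= 4] is meaningful. *)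

(** * Stars of bridges *)

Lemma sum_pair (V : nmodType) (A B : finType) (F : A * B -> V) :
  \sum_p F p = \sum_a \sum_b F (a, b).
Proof. by rewrite pair_bigA; apply: eq_bigr => -[]. Qed.

Section BridgeStar.

Variables I J : finType.

(** [I] indexes the bridges and [J * bool] the edges inside each block, the boolean
    being the sign.  The centre is [None]; in block [i], the bridge ends at
    [Some (i, false)] and the other vertex is [Some (i, true)]. *)
Definition bridge_star_end (h : (I + I * (J * bool)) * bool) : option (I * bool) :=
  match h with
  | (inl i, b) => if b then None else Some (i, false)
  | (inr (i, _), b) => Some (i, b)
  end.

Definition bridge_star_sign (e : I + I * (J * bool)) : bool :=
  if e is inr (_, (_, s)) then s else false.

Lemma bridge_star_loopless e :
  bridge_star_end (e, true) != bridge_star_end (e, false).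
Proof. by case: e => [i|[i p]] //=; apply/eqP => -[]. Qed.

Definition bridge_star : signed_graph :=
  @SignedGraph _ _ bridge_star_end bridge_star_sign bridge_star_loopless.

Variables (R : realType) (tau : half_edge bridge_star -> bool).
Variable f : edge bridge_star -> R.

Let flux (h : half_edge bridge_star) : R := (-1) ^+ tau h * f h.1.

Lemma boundaryE v : boundary tau f v =
  \sum_i (if bridge_star_end (inl i, true) == v then flux (inl i, true) else 0) +
  \sum_i (if bridge_star_end (inl i, false) == v then flux (inl i, false) else 0) +
  (\sum_p (if bridge_star_end (inr p, true) == v then flux (inr p, true) else 0) +
   \sum_p (if bridge_star_end (inr p, false) == v then flux (inr p, false) else 0)).
Proof.
rewrite /boundary big_mkcond sum_pair big_sumType /=.
by congr (_ + _); rewrite -big_split; apply: eq_bigr => ? _; rewrite big_bool.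
Qed.

Lemma boundary_centre :
  boundary tau f (None : vertex bridge_star) = \sum_i flux (inl i, true).
Proof.
rewrite boundaryE /= [X in _ + X + _]big1 // !(big1 (I := I * (J * bool))).
- by rewrite !addr0.
- by case.
- by case.
Qed.

Lemma sum_block i (F : I * (J * bool) -> R) :
  \sum_p (if p.1 == i then F p else 0) = \sum_q F (i, q).
Proof.
rewrite sum_pair (bigD1 i) //= [X in _ + X]big1 ?addr0 => [|k /negPf ki].
  by apply: eq_bigr => q _; rewrite eqxx.
by apply: big1 => q _; rewrite ki.
Qed.

Lemma boundary_far i : boundary tau f (Some (i, true) : vertex bridge_star) =
  \sum_q flux (inr (i, q), true).
Proof.
rewrite boundaryE /= 2?big1 ?add0r; last 2 first.
- by move=> k _; rewrite ifF //; apply/eqP => -[].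
- by [].
rewrite -(sum_block i (fun p => flux (inr p, true))).
rewrite [X in _ + X]big1 ?addr0 => [|[k p] _]; last first.
  by rewrite ifF //; apply/eqP => -[].
apply: eq_bigr => -[k p] _ /=; congr (if _ then _ else _).
by apply/eqP/eqP => [[]|->].
Qed.

Lemma boundary_near i : boundary tau f (Some (i, false) : vertex bridge_star) =
  flux (inl i, false) + \sum_q flux (inr (i, q), false).
Proof.
rewrite boundaryE /= big1 ?add0r //; congr (_ + _).
  rewrite (bigD1 i) //= eqxx big1 ?addr0 // => k /negPf ki.
  by rewrite ifF //; apply/eqP => -[/eqP]; rewrite ki.
rewrite -(sum_block i (fun p => flux (inr p, false))).
rewrite [X in X + _]big1 ?add0r => [|[k p] _]; last first.
  by rewrite ifF //; apply/eqP => -[].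
apply: eq_bigr => -[k p] _ /=; congr (if _ then _ else _).
by apply/eqP/eqP => [[]|->].
Qed.

End BridgeStar.

(** * The parity obstruction *)

Lemma orientation_bool (G : signed_graph) (tau : half_edge G -> bool) e :
  is_orientation tau -> tau (e, false) = tau (e, true) (+) ~~ signature e.
Proof.
move=> /(_ e).
by case: (tau (e, true)); case: (tau (e, false)); case: (signature e).
Qed.

(** A positive edge contributes opposite values at its two ends and a negative edge
    equal ones, so the sum of the boundaries over a block is the signed value of
    the bridge plus twice an integer. *)
Lemma bridge_even (I J : finType) (R : realType)
    (tau : half_edge (bridge_star I J) -> bool) (f : edge (bridge_star I J) -> R) i :
    is_orientation tau -> (forall v, boundary tau f v = 0) ->
    (forall e, f e \is a Num.int) ->
  exists m : int, f (inl i) = 2 * m%:~R.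
Proof.
move=> otau f0 fint.
(* [F q] is half of the joint contribution of the edge [q] at its two ends. *)
pose F (q : J * bool) : R :=
  (q.2 : nat)%:R * (-1) ^+ tau (inr (i, q), true) * f (inr (i, q)).
have /intrP[m mE] : \sum_q F q \is a Num.int.
  apply: rpred_sum => q _; apply: rpredM => //.
  by apply: rpredM; [exact: natr_int | apply: rpredX; rewrite rpredN1].
have sumE : (-1) ^+ tau (inl i, false) * f (inl i) + 2 * m%:~R = 0.
  have /= := congr2 +%R (f0 (Some (i, false))) (f0 (Some (i, true))).
  rewrite boundary_near boundary_far -addrA -big_split /= addr0 => <-.
  rewrite -mE mulr_sumr; congr (_ + _); apply: eq_bigr => -[j s] _.
  rewrite /F (orientation_bool _ otau) /=.
  by case: (tau (inr (i, (j, s)), true)); case: s => /=; ring.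
exists (- ((-1) ^+ tau (inl i, false) * m)).
move: sumE; rewrite rmorphN rmorphM /=.
by case: (tau (inl i, false)) => /= ?; rewrite ?rmorphN1 ?expr1 ?expr0 ?rmorph1; lra.
Qed.

(** Counted in units of [c], such a sum is [#|I|] minus twice the number of
    negative terms, hence odd. *)
Lemma odd_sum_neq0 (R : numDomainType) (I : finType) (c : R) (x : I -> R) :
  odd #|I| -> c != 0 -> (forall i, x i = c \/ x i = - c) -> \sum_i x i != 0.
Proof.
move=> oddI c0 xc; apply/negP => /eqP.
have xE i : x i = c - c *+ (x i != c).*2.
  case: (xc i) => ->; first by rewrite eqxx subr0.
  by case: eqP => [Nc|_] /=; rewrite ?subr0 // mulr2n opprD addrA subrr sub0r.
rewrite (eq_bigr _ (fun i _ => xE i)) sumrB sumr_const sumrMnr => /eqP.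
rewrite subr_eq0 -(mulr_natl c) -(mulr_natl c) (inj_eq (mulIf c0)) eqr_nat.
move=> /eqP eqI; move: oddI; rewrite -[#|_|]/(#|predT|) eqI.
by rewrite (big_morph _ oddD erefl) big1 // => i _; rewrite odd_double.
Qed.

Lemma bridge_star_integer_flow_ge4 (R : realType) (I J : finType) k :
  odd #|I| -> admits_nz_integer_flow R (bridge_star I J) k -> (4 <= k)%N.
Proof.
move=> oddI [tau [f [otau [_ fb f0] fnz fint]]].
rewrite leqNgt; apply/negP; rewrite ltnS => k3.
have /eqP := f0 None; rewrite boundary_centre; apply/negP.
apply: (odd_sum_neq0 (c := 2)) => // i /=.
have [m mE] := bridge_even i otau f0 fint.
have le2 : `|f (inl i)| <= 2.
  case: (fb (inl i)) => [->|/andP[_ /le_trans]]; first by rewrite normr0.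
  by apply; rewrite lerBlDr natr1 ler_nat.
suff : f (inl i) = 2 \/ f (inl i) = -2.
  by case: (tau (inl i, true)) => -[] ->; rewrite ?expr1 ?expr0;
    [right|left|left|right]; lra.
have /negP m0 : m != 0.
  by apply: contra_neq (fnz (inl i)) => m0; rewrite mE m0 mulr0.
have m1 : `|m| <= 1.
  rewrite -(ler_int R) intr_norm; move: le2; rewrite mE normrM ger0_norm //; lra.
rewrite mE; case: m m0 m1 {mE} => -[|[|n]] // _ _; first by left; rewrite mulr1.
by right; rewrite NegzE rmorphN /=; lra.
Qed.

(** * From rational flows to integer flows *)

(** Multiplying by [N] keeps every value at least [1] in absolute value; this is
    how a rational flow witnesses that integer flows exist. *)
Lemma integer_flow_of_scaling (R : realType) (G : signed_graph)
    (tau : half_edge G -> bool) (f : edge G -> R) (r : R) (N k : nat) :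
    is_orientation tau -> is_flow tau r f -> nowhere_zero f ->
    (0 < N)%N -> (forall e, N%:R * f e \is a Num.int) ->
    N%:R * (r - 1) <= k%:R - 1 ->
  admits_nz_integer_flow R G k.
Proof.
move=> otau [r2 fb f0] fnz N0 fint Nk.
have N1 : 1 <= N%:R :> R by rewrite ler1n.
exists tau, (fun e => N%:R * f e); split => //; last first.
  by move=> e; rewrite mulf_neq0 ?pnatr_eq0 -?lt0n.
split; first by nra.
  move=> e; right; case: (fb e) => [fe0|/andP[f1 fr]].
    by have := fnz e; rewrite fe0 eqxx.
  by rewrite normrM ger0_norm ?ler0n //; apply/andP; split; nra.
move=> v; rewrite -[RHS](mulr0 N%:R) -(f0 v) /boundary mulr_sumr.
by apply: eq_bigr => h _; rewrite mulrCA.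
Qed.

(** * A nowhere-zero flow with values close to one *)

Section SmallFlow.

Variables (R : realType) (t : nat).

Definition odd_star := bridge_star ('I_t + 'I_t.+1)%type ('I_t * bool)%type.

Definition odd_star_tau (h : half_edge odd_star) : bool :=
  match h with
  | (inl _, b) => ~~ b
  | (inr (_, (_, s)), b) => b && ~~ s
  end.

(** The two types of bridges balance at the centre: [t (1 + 1/t) = t + 1].  In a
    block with bridge value [g], the edges [((j, true), s)] and [((j, false), s)]
    together have value [g / (2t)]; the [t] such pairs of one sign [s] thus supply
    [g / 2], and the two signs together supply [g] at the bridge while they cancel
    at the other vertex. *)
Definition odd_star_flow (e : edge odd_star) : R :=
  match e with
  | inl (inl _) => 1 + t%:R^-1
  | inl (inr _) => -1
  | inr (inl _, ((_, b), _)) => if b then 1 + (1 + t%:R^-1) / (2 * t%:R) else -1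
  | inr (inr _, ((_, b), _)) => if b then - (1 + 1 / (2 * t%:R)) else 1
  end.

Lemma odd_star_tau_orientation : is_orientation odd_star_tau.
Proof. by case=> [i|[i [j []]]]. Qed.

Lemma odd_star_flow_nz : (0 < t)%N -> nowhere_zero odd_star_flow.
Proof.
move=> t_gt0.
have t0 : 0 < t%:R^-1 :> R by rewrite invr_gt0 ltr0n.
case=> [[i|i]|[[i|i] [[j []] s]]] /=; rewrite ?invfM; apply/eqP; nra.
Qed.

Lemma odd_star_flowP :
  (0 < t)%N -> is_flow odd_star_tau (2 + t%:R^-1) odd_star_flow.
Proof.
move=> t_gt0.
have tN0 : t%:R != 0 :> R by rewrite pnatr_eq0 -lt0n.
have t0 : 0 < t%:R^-1 :> R by rewrite invr_gt0 ltr0n.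
have t1 : t%:R^-1 <= 1 :> R by rewrite invf_le1 ?ler1n ?ltr0n.
split; first lra.
  move=> e; right.
  by case: e => [[i|i]|[[i|i] [[j []] s]]] /=; rewrite ?invfM ?normrN;
    rewrite ger0_norm; nra.
case=> [[i []]|].
- rewrite boundary_far sum_pair.
  by apply: big1 => -[j b] _; rewrite big_bool; case: i => i /=; ring.
- rewrite boundary_near !sum_pair.
  under eq_bigr do rewrite !big_bool.
  by case: i => i /=; rewrite sumr_const card_ord -mulr_natl; field.
rewrite boundary_centre big_sumType /= !sumr_const !card_ord.
rewrite expr0 !mul1r -(mulr_natl (1 + _)) -(mulr_natl (-1)) -(natr1 t).
by field.
Qed.

(** The factor clears the denominator of the value
    [1 + (1 + 1/t) / (2t) = 1 + (t + 1) / (2t^2)]. *)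
Lemma odd_star_flow_int e :
  (0 < t)%N -> (2 * t ^ 2)%:R * odd_star_flow e \is a Num.int.
Proof.
move=> t_gt0.
have tN0 : t%:R != 0 :> R by rewrite pnatr_eq0 -lt0n.
have -> : (2 * t ^ 2)%:R = 2 * t%:R ^+ 2 :> R by rewrite natrM natrX.
suff [z ->] : exists z : int, 2 * t%:R ^+ 2 * odd_star_flow e = z%:~R by [].
pose T : int := t; have -> : t%:R = T%:~R :> R by [].
have {}tN0 : T%:~R != 0 :> R by [].
case: e => [[i|i]|[[i|i] [[j []] s]]] /=.
- by exists (2 * T ^+ 2 + 2 * T); rewrite !(rmorphD, rmorphM, rmorphXn) /=; field.
- by exists (- (2 * T ^+ 2)); rewrite !(rmorphN, rmorphM, rmorphXn) /=; field.
- by exists (2 * T ^+ 2 + T + 1); rewrite !(rmorphD, rmorphM, rmorphXn) /=; field.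
- by exists (- (2 * T ^+ 2)); rewrite !(rmorphN, rmorphM, rmorphXn) /=; field.
- by exists (- (2 * T ^+ 2 + T)); rewrite !(rmorphN, rmorphD, rmorphM, rmorphXn) /=; field.
- by exists (2 * T ^+ 2); rewrite !(rmorphM, rmorphXn) /=; field.
Qed.

End SmallFlow.

(** * The gap *)

(** Some integer flow must exist, since otherwise the flow number is the default
    value [0]. *)
Lemma integer_flow_number_ge (R : realType) (G : signed_graph) (m : nat) :
    (exists k, admits_nz_integer_flow R G k) ->
    (forall k, admits_nz_integer_flow R G k -> (m <= k)%N) ->
  (m <= integer_flow_number R G)%N.
Proof.
move=> [k Gk] Gm; rewrite /integer_flow_number.
set P := (X in xget _ X); suff /(xgetPex 0%N)[Px _] : exists k, P k by exact: Gm.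
elim/ltn_ind: k Gk => k IHk Gk.
have [[j [jk Gj]]|min_k] :=
    pselect (exists j, (j < k)%N /\ admits_nz_integer_flow R G j).
  exact: IHk jk Gj.
exists k; split => // j Gj; rewrite leqNgt; apply/negP => jk.
by apply: min_k; exists j.
Qed.

Lemma circular_flow_number_le (R : realType) (G : signed_graph) (r : R) :
  admits_nz_flow G r -> circular_flow_number R G <= r.
Proof.
move=> Gr; apply: ge_inf => //; exists 2 => x [tau [f [_ [x2 _ _] _]]]; exact: x2.
Qed.

Theorem corollary2p2 (R : realType) : (2%:E <= delta_F R)%E.
Proof.
apply/lee_subgt0Pr => e e0.
pose t := (Num.truncn e^-1).+1.
have t_gt0 : (0 < t)%N by [].
have et : t%:R^-1 <= e.
  by rewrite -[e]invrK lef_pV2 ?posrE ?invr_gt0 ?ltr0n // ltW // truncnS_gt.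
have circ := @odd_star_flowP R t t_gt0.
have nz := @odd_star_flow_nz R t t_gt0.
have adm : admits_nz_flow (odd_star t) (2 + t%:R^-1 : R).
  exists (@odd_star_tau t), (@odd_star_flow R t); split => //.
  exact: odd_star_tau_orientation.
apply: (@le_trans _ _ ((integer_flow_number R (odd_star t))%:R -
    circular_flow_number R (odd_star t))%:E); last first.
  by apply: ereal_sup_ubound; exists (odd_star t); split => //; exists (2 + t%:R^-1).
have := circular_flow_number_le adm.
suff : 4 <= (integer_flow_number R (odd_star t))%:R :> R by rewrite lee_fin; lra.
rewrite ler_nat; apply: integer_flow_number_ge => [|k]; last first.
  apply: bridge_star_integer_flow_ge4.
  by rewrite card_sum !card_ord addnS addnn /= odd_double.
(* As [r <= 3], scaling by [N] gives values at most [2 * N <= 3 * N - 1]. *)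
exists (2 * t ^ 2 * 3)%N.
apply: (@integer_flow_of_scaling R _ (@odd_star_tau t) (@odd_star_flow R t)
  (2 + t%:R^-1) (2 * t ^ 2)) => //.
- exact: odd_star_tau_orientation.
- by move=> x; exact: odd_star_flow_int.
have t1 : t%:R^-1 <= 1 :> R by rewrite invf_le1 ?ler1n ?ltr0n.
have : 1 <= (2 * t ^ 2)%:R :> R by rewrite ler1n.
rewrite [(_ * 3)%:R]natrM; nra.
Qed.
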